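(* Let $\mathcal{B}$ be a bicomplex Banach space and let $K:\mathcal{B}\to\mathcal{B}$ be a bicomplex compact operator. Then: 1. Every invertible $\lambda\in\sigma(K)$ is an eigenvalue of $K$. 2. The eigenvalues of $K$ can only accumulate at noninvertible values. If the dimension of $\mathcal{B}$ is not finite, then $\sigma(K)$ must contain $0$, even if $0$ is not an eigenvalue. 3. $\sigma(K)$ is countable; in other words, its elements can be listed either as a finite list or as $\sigma(K)=\{\lambda_1,\lambda_2,\ldots\}$.
   Context: The bicomplex numbers $\mathbb{BC}$ are the elements $\zeta=z_1+jz_2$ with $z_1,z_2\in\mathbb{C}$, $i^2=j^2=-1$, $ij=ji$; they form a commutative ring. Put $\mathbf{e}_1=(1+ij)/2$, $\mathbf{e}_2=(1-ij)/2$, so $\mathbf{e}_1^2=\mathbf{e}_1$, $\mathbf{e}_2^2=\mathbf{e}_2$, $\mathbf{e}_1\mathbf{e}_2=0$, and every $\zeta\in\mathbb{BC}$ is uniquely $\zeta=\zeta_1\mathbf{e}_1+\zeta_2\mathbf{e}_2$ with $\zeta_1,\zeta_2\in\mathbb{C}$. The number $\zeta$ is (multiplicatively) noninvertible exactly when $\zeta_1=0$ or $\zeta_2=0$. The hyperbolic norm is $|\zeta|_{\mathbb{H}}=|\zeta_1|\mathbf{e}_1+|\zeta_2|\mathbf{e}_2$, and it induces the topology on $\mathbb{BC}$. A bicomplex Banach space is $\mathcal{B}=\mathcal{B}_1\mathbf{e}_1+\mathcal{B}_2\mathbf{e}_2$, where $\mathcal{B}_1,\mathcal{B}_2$ are complex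 Banach spaces of the same dimension; its elements are $v=v_1\mathbf{e}_1+v_2\mathbf{e}_2$ with $v_i\in\mathcal{B}_i$, scalar multiplication is componentwise ($\zeta v=\zeta_1v_1\mathbf{e}_1+\zeta_2v_2\mathbf{e}_2$), and the hyperbolic norm is $\|v\|_{\mathbb{H}}=\|v_1\|\mathbf{e}_1+\|v_2\|\mathbf{e}_2$. Hyperbolic norm convergence or boundedness means norm convergence or boundedness of both components. A (linear) operator $T$ on $\mathcal{B}$ has the form $T=T_1\mathbf{e}_1+T_2\mathbf{e}_2$ with $T_i$ a linear operator on $\mathcal{B}_i$, acting by $Tv=T_1v_1\mathbf{e}_1+T_2v_2\mathbf{e}_2$. An operator $K:\mathcal{B}\to\mathcal{B}$ is compact if for every bounded sequence $\{x_n\}$ in $\mathcal{B}$ the sequence $\{Kx_n\}$ has a hyperbolic norm-convergent subsequence. The spectrum of a bounded operator $T$ is $\sigma(T)=\{\zeta\in\mathbb{BC}:\zeta I-T\text{ is not invertible}\}$. An eigenvalue of $T$ is a $\lambda\in\mathbb{BC}$ with $(\lambda I-T)v=0$ for some $v=v_1\mathbf{e}_1+v_2\mathbf{e}_2\in\mathcal{B}$ with both $v_1$ and $v_2$ nonzero.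
   Formalization: The spectrum is taken as the set of ζ for which both components of ζI − K are noninvertible, i.e. σ(K₁)e₁ + σ(K₂)e₂; with plain noninvertibility of ζI − K, parts 1 and 3 are false (e.g. K = 0 has uncountable spectrum). *)

(* Defs.v *)
From HB Require Import structures.
From mathcomp Require Import all_boot all_order all_algebra.
From mathcomp Require Import complex.
From mathcomp Require Import all_classical all_reals all_analysis.
From mathcomp Require Import ring.
Import Order.TTheory GRing.Theory Num.Theory.
Import numFieldNormedType.Exports.

Set Implicit Arguments.
Unset Strict Implicit.
Unset Printing Implicit Defensive.

Local Open Scope classical_set_scope.
Local Open Scope ring_scope.
Local Open Scope complex_scope.

(* [BC z1 z2] is the bicomplex number z1 + j z2. *)
Record bicomplex (R : realType) := BC { bcre : R[i]; bcim : R[i] }.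

Section Bicomplex.
Variable R : realType.
Local Notation BCR := (bicomplex R).
Local Notation ii := ('i : R[i]).

Definition bc_pair (z : BCR) : R[i] * R[i] := (bcre z, bcim z).
Definition pair_bc (p : R[i] * R[i]) : BCR := BC p.1 p.2.
Lemma bc_pairK : cancel bc_pair pair_bc. Proof. by case. Qed.
HB.instance Definition _ := Equality.copy BCR (can_type bc_pairK).
HB.instance Definition _ := Choice.copy BCR (can_type bc_pairK).

Definition bc_add (z w : BCR) : BCR := BC (bcre z + bcre w) (bcim z + bcim w).
Definition bc_opp (z : BCR) : BCR := BC (- bcre z) (- bcim z).
Definition bc_mul (z w : BCR) : BCR :=
  BC (bcre z * bcre w - bcim z * bcim w) (bcre z * bcim w + bcim z * bcre w).

Lemma bc_addA : associative bc_add.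
Proof. by move=> [a b] [c d] [e f]; rewrite /bc_add /= !addrA. Qed.
Lemma bc_addC : commutative bc_add.
Proof.
by move=> [a b] [c d]; rewrite /bc_add /= [a + c]addrC [b + d]addrC.
Qed.
Lemma bc_add0 : left_id (BC 0 0) bc_add.
Proof. by move=> [a b]; rewrite /bc_add /= !add0r. Qed.
Lemma bc_addN : left_inverse (BC 0 0) bc_opp bc_add.
Proof. by move=> [a b]; rewrite /bc_add /= !addNr. Qed.
HB.instance Definition _ :=
  GRing.isZmodule.Build BCR bc_addA bc_addC bc_add0 bc_addN.

Lemma bc_mulA : associative bc_mul.
Proof.
by move=> [a b] [c d] [e f]; rewrite /bc_mul /=; congr BC; ring.
Qed.
Lemma bc_mulC : commutative bc_mul.
Proof. by move=> [a b] [c d]; rewrite /bc_mul /=; congr BC; ring. Qed.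
Lemma bc_mul1 : left_id (BC 1 0) bc_mul.
Proof. by move=> [a b]; rewrite /bc_mul /=; congr BC; ring. Qed.
Lemma bc_mulDl : left_distributive bc_mul bc_add.
Proof. by move=> [a b] [c d] [e f]; rewrite /bc_mul /bc_add /=; congr BC; ring. Qed.
Lemma bc_1neq0 : BC 1 0 != 0 :> BCR.
Proof. by apply/eqP => -[] /eqP; rewrite oner_eq0. Qed.
HB.instance Definition _ := GRing.Zmodule_isComNzRing.Build BCR
  bc_mulA bc_mulC bc_mul1 bc_mulDl bc_1neq0.

Definition bc_e1 : BCR := BC (1 / 2) (ii / 2).
Definition bc_e2 : BCR := BC (1 / 2) (- ii / 2).
Definition bc_of_C (a : R[i]) : BCR := BC a 0.

(* The idempotent coordinates: j e1 = - i e1 and j e2 = i e2, hence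
   z1 + j z2 = (z1 - i z2) e1 + (z1 + i z2) e2, see [bc_idemE] below. *)
Definition bc1 (z : BCR) : R[i] := bcre z - ii * bcim z.
Definition bc2 (z : BCR) : R[i] := bcre z + ii * bcim z.
Definition bc_idem (a b : R[i]) : BCR := bc_of_C a * bc_e1 + bc_of_C b * bc_e2.

Lemma ii2 : ii * ii = -1.
Proof. by rewrite -expr2 sqr_i. Qed.

Lemma bc_ext (z w : BCR) : bcre z = bcre w -> bcim z = bcim w -> z = w.
Proof. by case: z w => [a b] [c d] /= -> ->. Qed.

Lemma bc_idem_re a b : bcre (bc_idem a b) = (a + b) / 2.
Proof. by rewrite /= /bc_of_C /=; field. Qed.

Lemma bc_idem_im a b : bcim (bc_idem a b) = ii * (a - b) / 2.
Proof. by rewrite /= /bc_of_C /=; field. Qed.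

Lemma bc1_idem a b : bc1 (bc_idem a b) = a.
Proof.
rewrite /bc1 bc_idem_re bc_idem_im.
have -> : (a + b) / 2 - ii * (ii * (a - b) / 2) =
  (a + b) / 2 - (ii * ii) * ((a - b) / 2) by ring.
by rewrite ii2; field.
Qed.

Lemma bc2_idem a b : bc2 (bc_idem a b) = b.
Proof.
rewrite /bc2 bc_idem_re bc_idem_im.
have -> : (a + b) / 2 + ii * (ii * (a - b) / 2) =
  (a + b) / 2 + (ii * ii) * ((a - b) / 2) by ring.
by rewrite ii2; field.
Qed.

Lemma bc_idemE z : z = bc_of_C (bc1 z) * bc_e1 + bc_of_C (bc2 z) * bc_e2.
Proof.
rewrite -/(bc_idem _ _); apply: bc_ext.
  by rewrite bc_idem_re /bc1 /bc2; field.
rewrite bc_idem_im /bc1 /bc2.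
have -> : ii * (bcre z - ii * bcim z - (bcre z + ii * bcim z)) / 2 =
  - (ii * ii) * bcim z by field.
by rewrite ii2 opprK mul1r.
Qed.

Lemma bc_comp_inj z w : bc1 z = bc1 w -> bc2 z = bc2 w -> z = w.
Proof. by move=> h1 h2; rewrite [z]bc_idemE h1 h2 -bc_idemE. Qed.

Lemma bc1M z w : bc1 (z * w) = bc1 z * bc1 w.
Proof.
rewrite /bc1 /=.
have -> : (bcre z - ii * bcim z) * (bcre w - ii * bcim w) =
  bcre z * bcre w + (ii * ii) * (bcim z * bcim w)
  - ii * (bcre z * bcim w + bcim z * bcre w) by ring.
by rewrite ii2; ring.
Qed.

Lemma bc2M z w : bc2 (z * w) = bc2 z * bc2 w.
Proof.
rewrite /bc2 /=.
have -> : (bcre z + ii * bcim z) * (bcre w + ii * bcim w) =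
  bcre z * bcre w + (ii * ii) * (bcim z * bcim w)
  + ii * (bcre z * bcim w + bcim z * bcre w) by ring.
by rewrite ii2; ring.
Qed.

Lemma bc1_1 : bc1 1 = 1. Proof. by rewrite /bc1 /= mulr0 subr0. Qed.
Lemma bc2_1 : bc2 1 = 1. Proof. by rewrite /bc2 /= mulr0 addr0. Qed.
Lemma bc1D z w : bc1 (z + w) = bc1 z + bc1 w.
Proof. by rewrite /bc1 /=; ring. Qed.
Lemma bc2D z w : bc2 (z + w) = bc2 z + bc2 w.
Proof. by rewrite /bc2 /=; ring. Qed.

Definition bc_unit : pred BCR := [pred z | (bc1 z != 0) && (bc2 z != 0)].
Definition bc_inv (z : BCR) : BCR :=
  if bc_unit z then bc_idem (bc1 z)^-1 (bc2 z)^-1 else z.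

Lemma bc_mulV : {in bc_unit, left_inverse 1 bc_inv *%R}.
Proof.
move=> z uz; have := uz; rewrite inE => /andP[z1 z2].
rewrite /bc_inv; have -> : bc_unit z by exact: uz.
by apply: bc_comp_inj; rewrite ?(bc1M, bc2M) ?(bc1_idem, bc2_idem)
  ?(bc1_1, bc2_1) mulVf.
Qed.
Lemma bc_unitP (z w : BCR) : w * z = 1 -> bc_unit z.
Proof.
move=> wz; apply/andP; split; apply/eqP => z0.
  by have := bc1M w z; rewrite wz z0 mulr0 bc1_1 => /eqP; rewrite oner_eq0.
by have := bc2M w z; rewrite wz z0 mulr0 bc2_1 => /eqP; rewrite oner_eq0.
Qed.
Lemma bc_inv_out : {in [predC bc_unit], bc_inv =1 id}.
Proof. by move=> z; rewrite inE /bc_inv => /negPf; rewrite -topredE /= => ->. Qed.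
HB.instance Definition _ := GRing.ComNzRing_hasMulInverse.Build BCR
  bc_mulV bc_unitP bc_inv_out.

Lemma bc_unitE (z : BCR) :
  (z \is a GRing.unit) = (bc1 z != 0) && (bc2 z != 0).
Proof. by []. Qed.

(* The hyperbolic norm |z|_H = |z_1| e1 + |z_2| e2 is small when both of its
   coordinates are, so its topology is the product topology in the idempotent
   coordinates. *)
Definition bc_coord (z : BCR) : R[i]^o * R[i]^o := (bc1 z, bc2 z).
HB.instance Definition _ := Topological.copy BCR (initial_topology bc_coord).

End Bicomplex.

Section Dimension.
Variables (R : realType) (V : lmodType R[i]).

Definition lin_indep (b : set V) : Prop :=
  forall (s : seq V) (c : V -> R[i]), uniq s -> (forall x, x \in s -> b x) ->
    \sum_(x <- s) c x *: x = 0 -> forall x, x \in s -> c x = 0.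

Definition generates (b : set V) : Prop :=
  forall v : V, exists (s : seq V) (c : V -> R[i]),
    (forall x, x \in s -> b x) /\ v = \sum_(x <- s) c x *: x.

Definition lin_basis (b : set V) : Prop := lin_indep b /\ generates b.

Definition finite_dimensional : Prop :=
  exists b : set V, lin_basis b /\ finite_set b.

End Dimension.

(* Dimension is the cardinality of a linear (Hamel) basis. *)
Definition same_dimension (R : realType) (V W : lmodType R[i]) : Prop :=
  exists (b : set V) (c : set W),
    [/\ lin_basis b, lin_basis c & (b #= c)%card].

Record bcBanach (R : realType) := BCBanach {
  comp1 : completeNormedModType R[i];
  comp2 : completeNormedModType R[i];
  comp_dim : same_dimension comp1 comp2 }.

(* The pair (v1, v2) is the vector v1 e1 + v2 e2. *)
Definition bcvec (R : realType) (B : bcBanach R) : Type :=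
  (comp1 B * comp2 B)%type.

Section BicomplexBanach.
Variables (R : realType) (B : bcBanach R).
Local Notation BV := (bcvec B).

HB.instance Definition _ := GRing.Zmodule.on BV.

Definition bc_scale (z : bicomplex R) (v : BV) : BV :=
  (bc1 z *: v.1, bc2 z *: v.2).

Lemma bc_scaleA z w v : bc_scale z (bc_scale w v) = bc_scale (z * w) v.
Proof. by rewrite /bc_scale /= !scalerA bc1M bc2M. Qed.
Lemma bc_scale1 : left_id 1 bc_scale.
Proof. by case=> v1 v2; rewrite /bc_scale bc1_1 bc2_1 !scale1r. Qed.
Lemma bc_scaleDr : right_distributive bc_scale +%R.
Proof. by move=> z [v1 v2] [w1 w2]; rewrite /bc_scale /= !scalerDr. Qed.
Lemma bc_scaleDl v : {morph bc_scale^~ v : z w / z + w}.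
Proof. by move=> z w; rewrite /bc_scale bc1D bc2D !scalerDl. Qed.
HB.instance Definition _ := GRing.Zmodule_isLmodule.Build (bicomplex R) BV
  bc_scaleA bc_scale1 bc_scaleDr bc_scaleDl.

(* [BCOp T1 T2] is the operator T1 e1 + T2 e2. *)
Record bcop := BCOp {
  op1 : {linear comp1 B -> comp1 B};
  op2 : {linear comp2 B -> comp2 B} }.

Definition bcapp (T : bcop) (v : BV) : BV := (op1 T v.1, op2 T v.2).

(* zI - T *)
Definition bc_shift (z : bicomplex R) (T : bcop) : bcop :=
  BCOp (bc1 z \*: idfun \- op1 T) (bc2 z \*: idfun \- op2 T).

Lemma bc_shiftE z T v : bcapp (bc_shift z T) v = z *: v - bcapp T v.
Proof. by []. Qed.

Definition hbounded (x : nat -> BV) : Prop :=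
  exists M : R[i], forall n, `|(x n).1| <= M /\ `|(x n).2| <= M.

Definition hcvg (x : nat -> BV) (y : BV) : Prop :=
  ((fun n => (x n).1) @ \oo --> y.1) /\ ((fun n => (x n).2) @ \oo --> y.2).

Definition compact_op (K : bcop) : Prop :=
  forall x : nat -> BV, hbounded x ->
    exists phi : nat -> nat, {homo phi : m n / (m < n)%N} /\
      exists y : BV, hcvg (fun n => bcapp K (x (phi n))) y.

Definition bc_eigenvalue (T : bcop) : set (bicomplex R) :=
  [set z | exists v : BV,
     [/\ v.1 != 0, v.2 != 0 & bcapp (bc_shift z T) v = 0]].

(* Invertibility in the algebra of bounded operators. *)
Definition bounded_inverse (V : normedModType R[i]) (T : V -> V) : Prop :=
  exists S : {linear V -> V},
    [/\ (exists M : R[i], forall v, `|S v| <= M * `|v|),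
        cancel S T & cancel T S].

(* "Not invertible" is read in both components, as for eigenvectors: neither
   component of zI - T is invertible, so that the spectrum of T is
   sigma(T1) e1 + sigma(T2) e2.  The set of all z for which zI - T lacks a
   two-sided inverse is (sigma(T1) x C) U (C x sigma(T2)) in idempotent
   coordinates, which is uncountable for every bounded T as soon as B <> 0. *)
Definition bc_noninvertible (T : bcop) : Prop :=
  ~ bounded_inverse (op1 T) /\ ~ bounded_inverse (op2 T).

Definition bc_spectrum (T : bcop) : set (bicomplex R) :=
  [set z | bc_noninvertible (bc_shift z T)].

(* The components have the same dimension, so either may be tested. *)
Definition bc_finite_dimensional : Prop :=
  finite_dimensional (comp1 B) /\ finite_dimensional (comp2 B).

End BicomplexBanach.

(* Main.v *)
Require Import Defs.
From HB Require Import structures.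
From mathcomp Require Import all_boot all_order all_algebra.
From mathcomp Require Import complex.
From mathcomp Require Import all_classical all_reals all_analysis.
Import Order.TTheory GRing.Theory Num.Theory.
Import numFieldNormedType.Exports.

(** A bicomplex compact operator is a pair of compact operators on two complex
normed spaces, so everything reduces to the classical theory of one compact
operator K, which is built here on the sequential definition of compactness.

One argument drives the whole theory ([compact_map_no_chain]). By the Riesz
lemma, a strict inclusion Y < Z of subspaces, Y closed, gives a unit vector of
Z at distance at least 1/2 from Y. If there are infinitely many such pairs
(Y_n, Z_n), if K acts on Z_n as a scalar mu_n modulo Y_n with the mu_n bounded
away from 0, and if the pairs form an increasing or a decreasing chain of
K-invariant subspaces, then the unit vectors x_n have images K x_n that stay
uniformly apart, against compactness. It is used three times.

- Ranges. If z is nonzero and not an eigenvalue, T = z - K is bounded below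
  and has closed ranges T^n V; were T not surjective, these would be strictly
  decreasing, and K = z modulo T. So T has a bounded inverse
  ([fredholm_alternative]): nonzero spectral values are eigenvalues.

- Eigenvalues. Distinct eigenvalues l_0, l_1, ... with |l_n| >= e give the
  strictly increasing closed subspaces ker ((K - l_0) ... (K - l_(n-1))). So
  only finitely many eigenvalues have modulus at least e
  ([eigenvalues_away_from_0_finite]), hence the nonzero ones are isolated and
  the spectrum is countable.

- Spans. If the identity is compact, an infinite independent sequence would
  give strictly increasing spans, closed because the scalars are locally
  compact ([compact_identity_lin_indep_finite]). An invertible compact operator
  makes the identity compact, so 0 is in the spectrum in infinite dimension;
  a finite basis of one component makes the other finite-dimensional too,
  because the two dimensions agree.

The last step takes idempotent coordinates: an invertible bicomplex number has
two nonzero coordinates, a neighbourhood of it contains a product of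
neighbourhoods of the coordinates, and the spectrum is contained in the product
of the two component spectra.

Norms take their values in the complex numbers, ordered partially; all the
values that are compared are real. *)

Set Implicit Arguments.
Unset Strict Implicit.
Unset Printing Implicit Defensive.

Local Open Scope classical_set_scope.
Local Open Scope ring_scope.

Section CompactOperators.
Context {R : realType}.
Local Notation C := R[i].
Implicit Types V W : normedModType C.

(** * Sequences and compact maps *)

Lemma complex_natr_gt (M : C) : 0 <= M -> exists n : nat, M < n.+1%:R.
Proof.
move=> M0; have /complex_realP[r Mr] : M \is Num.real by exact: ger0_real.
exists (Num.truncn r).
by rewrite Mr -(rmorph_nat (real_complex R)) /= ltcR truncnS_gt.
Qed.

Lemma cvg_harmonic_bound V (x : nat -> V) (l : V) (M : C) : 0 <= M ->
  (forall n, `|l - x n| <= M / n.+1%:R) -> x @ \oo --> l.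
Proof.
move=> M0 xl; apply/cvgrPdist_le => e e0.
have [|N MN] := @complex_natr_gt (M / e); first by rewrite divr_ge0// ltW.
exists N => // n /= Nn; apply: le_trans (xl n) _.
rewrite ler_pdivrMr ?ltr0n// mulrC -ler_pdivrMr//.
by rewrite (le_trans (ltW MN))// ler_nat.
Qed.

Lemma homo_lt_geid (phi : nat -> nat) :
  {homo phi : m n / (m < n)%N} -> forall n, (n <= phi n)%N.
Proof.
by move=> hphi; elim=> // n IH; apply: leq_ltn_trans IH (hphi _ _ _).
Qed.

Lemma homo_lt_cvgnoo (phi : nat -> nat) :
  {homo phi : m n / (m < n)%N} -> phi @ \oo --> \oo.
Proof.
move=> hphi; apply/cvgnyPge => N; exists N => // n /= Nn.
exact: leq_trans Nn (homo_lt_geid hphi n).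
Qed.

Definition compact_map V W (f : V -> W) : Prop := forall x : nat -> V,
  (exists M : C, forall n, `|x n| <= M) ->
  exists phi : nat -> nat, {homo phi : m n / (m < n)%N} /\
    exists y : W, (fun n => f (x (phi n))) @ \oo --> y.

(** Boundedness comes with compactness: unit-size vectors with images of norm
above n would have no subsequence with a bounded image. *)
Lemma compact_map_bounded V W (f : {linear V -> W}) : compact_map f ->
  exists M : C, 0 < M /\ forall v, `|f v| <= M * `|v|.
Proof.
move=> cf; apply: contrapT => nb.
have unb n : exists v : V, `|v| <= 1 /\ n.+1%:R < `|f v|.
  apply: contrapT => /forallNP nv; apply: nb; exists n.+1%:R.
  split=> [|v]; first by rewrite ltr0n.
  have [->|v0] := eqVneq v 0; first by rewrite linear0 !normr0 mulr0.
  have {}v0 : 0 < `|v| by rewrite normr_gt0.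
  have := nv (`|v|^-1 *: v); rewrite linearZ /= !normrZ normfV normr_id.
  rewrite mulVf ?gt_eqF// lexx => /not_andP[//|/negP].
  rewrite -real_leNgt ?realn// ?realM ?realV ?normr_real//.
  by rewrite mulrC ler_pdivrMr.
have [x /all_and2[x1 xn]] := choice unb.
have [|phi [hphi [y /cvgrPdist_lt/(_ 1 ltr01)[N _ yN]]]] := cf x.
  by exists 1.
have [|K yK] := @complex_natr_gt (`|y| + 1); first by rewrite addr_ge0.
set m := maxn N K; have := yN m (leq_maxl _ _); apply/negP.
rewrite -real_leNgt ?normr_real//.
rewrite distrC; apply: le_trans (lerB_dist _ _); rewrite lerBrDl.
apply: le_trans (ltW (xn _)); rewrite (le_trans (ltW yK))// ler_nat ltnS.
exact: leq_trans (leq_maxr N K) (homo_lt_geid hphi _).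
Qed.

Lemma compact_map_continuous V W (f : {linear V -> W}) :
  compact_map f -> continuous f.
Proof.
move=> /compact_map_bounded[M [M0 fM]].
apply/linear_bounded_continuous/linear_boundedP.
exists M; split; first exact: gtr0_real.
by move=> r /ltW Mr v; rewrite (le_trans (fM v))// ler_wpM2r.
Qed.

(** * The Riesz lemma and chains of subspaces *)

Definition linear_subspace V (Y : set V) : Prop :=
  Y 0 /\ forall (a : C) x y, Y x -> Y y -> Y (a *: x + y).

Lemma subspaceZ V (Y : set V) a x : linear_subspace Y -> Y x -> Y (a *: x).
Proof. by move=> [Y0 YD] Yx; rewrite -[_ *: _]addr0; exact: YD. Qed.

Lemma subspaceD V (Y : set V) x y :
  linear_subspace Y -> Y x -> Y y -> Y (x + y).
Proof. by move=> [Y0 YD] Yx; rewrite -[x]scale1r; exact: YD. Qed.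

Lemma subspaceB V (Y : set V) x y :
  linear_subspace Y -> Y x -> Y y -> Y (x - y).
Proof.
move=> Ysub Yx Yy; apply: subspaceD => //.
by rewrite -scaleN1r; exact: subspaceZ.
Qed.

(** If no point of Y were best up to a factor 2, then starting at 0 the distance
to u could be halved for ever within Y, and u would be a limit of points of Y.
The factor 2 spares the infimum of a set of complex-valued distances. *)
Lemma nearly_best_approximation V (Y : set V) (u : V) :
  closed Y -> Y 0 -> ~ Y u ->
  exists2 y, Y y & forall y', Y y' -> `|u - y| <= `|u - y'| *+ 2.
Proof.
move=> Ycl Y0 Yu; apply: contrapT => nbest; apply: Yu.
have halve y : exists y', Y y -> Y y' /\ `|u - y'| *+ 2 <= `|u - y|.
  have [Yy|] := pselect (Y y); last by exists 0.
  apply: contrapT => /forallNP ny; apply: nbest; exists y => // y' Yy'.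
  have /not_implyP[_ /not_andP[//|/negP]] := ny y'.
  by rewrite -real_ltNge ?realMn ?normr_real// => /ltW.
have [f fP] := choice halve.
have Yf n : Y (iter n f 0) by elim: n => //= n /fP[].
suff fu : (fun n => iter n f 0) @ \oo --> u.
  by apply: (closed_cvg Y Ycl _ _ fu); exact: nearW.
apply: (@cvg_harmonic_bound _ _ _ `|u|) => // n.
suff : `|u - iter n f 0| *+ 2 ^ n <= `|u|.
  move=> h; rewrite ler_pdivlMr ?ltr0n// mulr_natr.
  by apply: le_trans h; rewrite ler_wpMn2l// ltn_expl.
elim: n => [|n IH]; first by rewrite /= subr0.
rewrite expnS mulrnA (le_trans _ IH)//= lerMn2r; apply/orP; right.
by have [] := fP _ (Yf n).
Qed.

Lemma riesz_lemma V (Y Z : set V) (u : V) :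
  closed Y -> linear_subspace Y -> linear_subspace Z -> Y `<=` Z ->
  Z u -> ~ Y u ->
  exists x, [/\ Z x, `|x| = 1 & forall y, Y y -> 1 / 2 <= `|x - y|].
Proof.
move=> Ycl Ysub Zsub YZ Zu Yu.
have [y Yy ybest] := nearly_best_approximation Ycl Ysub.1 Yu.
have d0 : 0 < `|u - y|.
  by rewrite normr_gt0 subr_eq0; apply/eqP => uy; apply: Yu; rewrite uy.
exists (`|u - y|^-1 *: (u - y)); split.
- by apply: subspaceZ => //; apply: subspaceB => //; exact: YZ.
- by rewrite normrZ normfV normr_id mulVf// gt_eqF.
move=> y' Yy'.
(* scaled by the norm of u - y, the vector y' is a competitor of y *)
have -> : `|u - y|^-1 *: (u - y) - y' =
    `|u - y|^-1 *: (u - (`|u - y| *: y' + y)).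
  rewrite [in RHS]opprD [in RHS]addrCA [RHS]scalerDr [in RHS]scalerN.
  by rewrite scalerA mulVf ?gt_eqF// scale1r [LHS]addrC.
rewrite normrZ normfV normr_id [leRHS]mulrC ler_pdivlMr// mulrAC mul1r.
rewrite ler_pdivrMr// mulr_natr; apply: ybest; exact: Ysub.2.
Qed.

Lemma compact_map_not_separated V W (f : V -> W) (x : nat -> V) (d : C) :
  compact_map f -> (exists M : C, forall n, `|x n| <= M) -> 0 < d ->
  (forall m n, (m < n)%N -> d <= `|f (x m) - f (x n)|) -> False.
Proof.
move=> cf bx d0 sep; have [phi [hphi [y /cvgrPdist_lt cy]]] := cf x bx.
have [|N _ yN] := cy (d / 2); first exact: divr_gt0.
have := sep _ _ (hphi _ _ (ltnSn N)); apply/negP.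
rewrite -real_ltNge ?normr_real ?gtr0_real//.
rewrite (splitr d); apply: le_lt_trans (ler_distD y _ _) (ltrD _ _).
  by rewrite distrC; apply: yN => /=.
by apply: yN => /=.
Qed.

(** For x_n the unit vector that the Riesz lemma gives for Y n < Z n, the image
K x_n is mu_n x_n modulo Y n, so its distance to Y n is at least e / 2. The two
alternatives of the last hypothesis stand for increasing and decreasing chains:
in both, of two images one lies in the closed subspace from which the other
keeps its distance. *)
Lemma compact_map_no_chain V (K : {linear V -> V}) (Y Z : nat -> set V)
    (mu : nat -> C) (e : C) :
  compact_map K -> 0 < e -> (forall n, e <= `|mu n|) ->
  (forall n, closed (Y n)) ->
  (forall n, linear_subspace (Y n)) -> (forall n, linear_subspace (Z n)) ->
  (forall n, Y n `<=` Z n) -> (forall n, exists2 u, Z n u & ~ Y n u) ->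
  (forall n x, Z n x -> Y n (K x - mu n *: x)) ->
  (forall m n x, (m < n)%N -> Z m x -> Y n (K x)) \/
  (forall m n x, (m < n)%N -> Z n x -> Y m (K x)) -> False.
Proof.
move=> cK e0 emu Ycl Ysub Zsub YZ YneqZ KmuY KYZ.
have /choice[x xP] : forall n, exists x,
    [/\ Z n x, `|x| = 1 & forall y, Y n y -> 1 / 2 <= `|x - y|].
  by move=> n; have [u Zu Yu] := YneqZ n; exact: (riesz_lemma _ _ _ _ Zu Yu).
have far n w : Y n w -> e / 2 <= `|K (x n) - w|.
  move=> Yw; have [Zx _ xY] := xP n.
  have mu0 : mu n != 0 by rewrite -normr_gt0; apply: lt_le_trans (emu n).
  have -> : K (x n) - w =
      mu n *: (x n - (mu n)^-1 *: (w - (K (x n) - mu n *: x n))).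
    rewrite scalerBr scalerA divff// scale1r opprB.
    by rewrite addrA [mu n *: x n + _]addrC subrK.
  rewrite normrZ; apply: ler_pM => //; first exact: ltW.
  rewrite -[2^-1]div1r.
  apply: xY; apply: subspaceZ => //; apply: subspaceB => //; exact: KmuY.
apply: (compact_map_not_separated cK (x := x) (d := e / 2)).
- by exists 1 => n; have [_ ->] := xP n.
- exact: divr_gt0.
- move=> m n mn; case: KYZ => KYZ.
    by rewrite distrC; apply: far; apply: KYZ mn _; have [] := xP m.
  by apply: far; apply: KYZ mn _; have [] := xP n.
Qed.

(** * The Fredholm alternative *)

(** The identity z x = (z x - K x) + K x turns convergence of the first term,
together with compactness of K, into convergence of a subsequence of x. *)
Lemma shift_compact_subsequence V (K : {linear V -> V}) (z : C)
    (x : nat -> V) (w : V) :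
  compact_map K -> z != 0 -> (exists M : C, forall n, `|x n| <= M) ->
  (fun n => z *: x n - K (x n)) @ \oo --> w ->
  exists phi : nat -> nat, exists y : V,
    (x \o phi) @ \oo --> y /\ z *: y - K y = w.
Proof.
move=> cK z0 bx xw; have [phi [hphi [y yK]]] := cK x bx.
have xphiw := cvg_comp _ _ (homo_lt_cvgnoo hphi) xw.
have xphi : (x \o phi) @ \oo --> z^-1 *: (w + y).
  rewrite (_ : x \o phi = fun n =>
      z^-1 *: ((z *: x (phi n) - K (x (phi n))) + K (x (phi n)))).
    apply: cvgZl_tmp; apply: cvgD xphiw yK.
  by apply/funext => n /=; rewrite subrK scalerA mulVf// scale1r.
exists phi, (z^-1 *: (w + y)); split=> //.
have Kxphi : (fun n => K (x (phi n))) @ \oo --> K (z^-1 *: (w + y)).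
  by apply: continuous_cvg xphi; exact: compact_map_continuous cK _.
have -> : K (z^-1 *: (w + y)) = y.
  exact: (cvg_unique (@norm_hausdorff _ _) Kxphi yK).
by rewrite scalerA divff// scale1r addrK.
Qed.

(** Otherwise unit vectors with z x - K x tending to 0 would subconverge to a
unit vector killed by z - K. *)
Lemma shift_compact_bounded_below V (K : {linear V -> V}) (z : C) :
  compact_map K -> z != 0 -> (forall v, z *: v = K v -> v = 0) ->
  exists2 c : C, 0 < c & forall v, c * `|v| <= `|z *: v - K v|.
Proof.
move=> cK z0 inj; apply: contrapT => nb.
have /choice[x /all_and2[x1 xn]] : forall n : nat, exists x : V,
    `|x| = 1 /\ `|z *: x - K x| <= n.+1%:R^-1.
  move=> n; apply: contrapT => /forallNP nx; apply: nb; exists n.+1%:R^-1.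
    by rewrite invr_gt0 ltr0n.
  move=> v; have [->|v0] := eqVneq v 0; first by rewrite normr0 mulr0.
  have {}v0 : 0 < `|v| by rewrite normr_gt0.
  have /not_andP[|/negP] := nx (`|v|^-1 *: v).
    by rewrite normrZ normfV normr_id mulVf// gt_eqF.
  rewrite -real_ltNge ?normr_real ?realV ?realn//.
  rewrite [K _]linearZ /= scalerA [z * _]mulrC -scalerA -scalerBr.
  rewrite normrZ normfV normr_id.
  by rewrite [ltRHS]mulrC ltr_pdivlMr// => /ltW.
have [||phi [y [xy zy]]] := @shift_compact_subsequence _ K z x 0 cK z0.
- by exists 1 => n; rewrite x1.
- apply: (@cvg_harmonic_bound _ _ _ 1) => // n.
  by rewrite sub0r normrN mul1r.
have y0 : y = 0 by apply: inj; apply/eqP; rewrite -subr_eq0 zy.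
have /cvgrPdist_lt/(_ 1 ltr01)[N _ /(_ N (leqnn N))] := xy.
by rewrite y0 sub0r normrN /= x1 ltxx.
Qed.

Lemma closure_seq V (A : set V) (w : V) : closure A w ->
  exists x : nat -> V, (forall n, A (x n)) /\
    forall n, `|w - x n| <= n.+1%:R^-1.
Proof.
move=> Aw; suff /choice[x /all_and2[Ax xw]] : forall n : nat,
    exists y, A y /\ `|w - y| <= n.+1%:R^-1 by exists x.
move=> n; have n0 : 0 < n.+1%:R^-1 :> C by rewrite invr_gt0 ltr0n.
have [y [Ay wy]] := Aw _ (nbhsx_ballx w _ n0).
by exists y; split=> //; move: wy; rewrite -ball_normE => /ltW.
Qed.

(** Preimages of a convergent sequence are bounded because z - K is bounded
below, so a subsequence of them converges, and its limit stays in Y. *)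
Lemma shift_compact_closed_image V (K : {linear V -> V}) (z c : C)
    (Y : set V) : compact_map K -> z != 0 -> 0 < c ->
  (forall v, c * `|v| <= `|z *: v - K v|) ->
  closed Y -> closed ((fun v => z *: v - K v) @` Y).
Proof.
move=> cK z0 c0 below Ycl w /closure_seq[t [tY tw]].
have /choice[x /all_and2[Yx xt]] : forall n, exists x,
    Y x /\ z *: x - K x = t n.
  by move=> n; have [x Yx <-] := tY n; exists x.
have [||phi [y [xy <-]]] := @shift_compact_subsequence _ K z x w cK z0.
- exists ((`|w| + 1) / c) => n; rewrite ler_pdivlMr// mulrC.
  apply: le_trans (below _) _; rewrite xt -[t n](subrK w) addrC.
  apply: le_trans (ler_normD _ _) _; rewrite lerD2l distrC.
  by apply: le_trans (tw n) _; rewrite invf_le1 ?ler1n ?ltr0n.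
- apply: (@cvg_harmonic_bound _ _ _ 1) => // n.
  by rewrite xt mul1r.
exists y => //; apply: (closed_cvg Y Ycl _ _ xy).
by apply: nearW => n /=.
Qed.

(** If w is not in the range of T = z - K then T^n w is in the n-th range but,
T being injective, not in the next one: the ranges of the powers of T form a
strictly decreasing chain. *)
Lemma shift_compact_surjective V (K : {linear V -> V}) (z : C) :
  compact_map K -> z != 0 -> (forall v, z *: v = K v -> v = 0) ->
  forall w, exists v, z *: v - K v = w.
Proof.
move=> cK z0 inj; apply: contrapT => /existsNP[w /forallNP ww].
have [c c0 below] := shift_compact_bounded_below cK z0 inj.
pose T : {linear V -> V} := z \*: idfun \- K.
have TE v : T v = z *: v - K v by [].
have Tinj u v : T u = T v -> u = v.
  move=> /eqP; rewrite -subr_eq0 -linearB TE subr_eq0 => /eqP/inj/eqP.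
  by rewrite subr_eq0 => /eqP.
pose Z n := iter n (fun Y : set V => T @` Y) setT.
have Zcl n : closed (Z n).
  elim: n => [|n IH]; first exact: closedT.
  exact: (shift_compact_closed_image cK z0 c0 below IH).
have Zsub n : linear_subspace (Z n).
  elim: n => [|n [Z0 ZD]] //; split; first by exists 0; rewrite ?linear0.
  move=> a _ _ [x Zx <-] [y Zy <-].
  by exists (a *: x + y); rewrite ?linearP//; exact: ZD.
have Zdec n : Z n.+1 `<=` Z n.
  elim: n => [|n IH] // _ [x Zx <-]; exists x => //; exact: IH.
have Zle m n : (m <= n)%N -> Z n `<=` Z m.
  elim: n => [|n IH]; first by rewrite leqn0 => /eqP ->.
  rewrite leq_eqVlt => /predU1P[->//|]; rewrite ltnS => /IH ZZ x /Zdec.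
  exact: ZZ.
have KZ n x : Z n x -> Z n (K x).
  elim: n x => [//|n IH] _ [x Zx <-]; exists (K x); first exact: IH.
  by rewrite !TE linearB linearZ.
apply: (@compact_map_no_chain _ K (fun n => Z n.+1) Z (fun=> z) `|z| cK) => //.
- by rewrite normr_gt0.
- move=> n; exists (iter n T w).
    by elim: n => //= n IH; exists (iter n T w).
  elim: n => [[v _ vw]|n IH [v Zv /Tinj vE]]; first exact: ww vw.
  by apply: IH; move: Zv; rewrite vE.
- move=> n x Zx; rewrite -opprB -TE -scaleN1r; apply: subspaceZ => //.
  by exists x.
- right=> m n x mn Zx; apply: KZ; exact: Zle Zx.
Qed.

Lemma fredholm_alternative V (K : {linear V -> V}) (z : C) :
  compact_map K -> z != 0 ->
  ~ bounded_inverse (z \*: idfun \- K) -> exists2 v, v != 0 & z *: v = K v.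
Proof.
move=> cK z0; apply: contra_notP => /forall2NP nev.
have inj v : z *: v = K v -> v = 0.
  by move=> zv; have [/negP|//] := nev v; rewrite negbK => /eqP.
have [c c0 below] := shift_compact_bounded_below cK z0 inj.
have /choice[S TS] := shift_compact_surjective cK z0 inj.
pose T : {linear V -> V} := z \*: idfun \- K.
have Tinj : injective T.
  move=> u v /eqP; rewrite -subr_eq0 -linearB /= subr_eq0 => /eqP/inj/eqP.
  by rewrite subr_eq0 => /eqP.
have STK : cancel T S by move=> v; apply: Tinj; exact: TS.
have Slin : linear S.
  move=> a u v; apply: Tinj; rewrite linearP.
  by rewrite -[T (S u)]/(z *: _ - K _) -[T (S v)]/(z *: _ - K _) !TS; exact: TS.
pose Sl := GRing.isLinear.Build C V V _ S Slin.
pose SL : {linear V -> V} := HB.pack S Sl.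
exists SL; split=> //.
exists c^-1 => v; rewrite mulrC ler_pdivlMr// mulrC.
by apply: le_trans (below _) _; rewrite TS.
Qed.

(** * Eigenvalues and spectrum *)

Lemma infinite_set_seq (T : Type) (A : set T) : infinite_set A ->
  exists x : nat -> T, injective x /\ forall n, A (x n).
Proof.
move=> /infiniteP/card_leP[f].
exists (fun n => val (f (SigSub (mem_setT n)))); split=> [m n|n].
  by move=> /val_inj/(@inj _ _ _ f _ _ (mem_setT _) (mem_setT _))[].
exact: set_valP.
Qed.

(** The chain is made of kernels of the products (K - l_0) ... (K - l_(n-1))
instead of spans of eigenvectors, because kernels of continuous maps are closed
for free. *)
Lemma eigenvalues_away_from_0_finite V (K : {linear V -> V}) (e : C) :
  compact_map K -> 0 < e ->
  finite_set [set l : C | e <= `|l| /\ exists2 v, v != 0 & l *: v = K v].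
Proof.
move=> cK e0; apply: contrapT => /infinite_set_seq[l [linj /all_and2[el]]].
move=> /(_ _)/cid2-/all_sig2[v v0 vP].
pose P := fix P n : {linear V -> V} :=
  if n is m.+1 then P m \o (K \- l m \*: idfun) else idfun.
have PS n x : P n.+1 x = P n (K x - l n *: x) by [].
have Pcont n : continuous (P n).
  elim: n => [|n IH] x //=.
  apply: continuous_comp; last exact: IH.
  apply: cvgB; first exact: compact_map_continuous.
  by apply: cvgZl_tmp; exact: cvg_id.
have PK n x : P n (K x) = K (P n x).
  elim: n x => [//|n IH] x; rewrite !PS -IH; congr (P n _).
  by rewrite [RHS]linearB [in RHS]linearZ_LR.
have Pdec n x : P n x = 0 -> P n.+1 x = 0.
  by move=> Px; rewrite PS linearB linearZ /= PK Px linear0 scaler0 subr0.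
have Ple m n x : (m <= n)%N -> P m x = 0 -> P n x = 0.
  move=> + Pm; elim: n => [|n IH]; first by rewrite leqn0 => /eqP <-.
  by rewrite leq_eqVlt => /predU1P[<-//|/IH]; exact: Pdec.
pose Y n : set V := [set x | P n x = 0].
have Ysub n : linear_subspace (Y n).
  split; first exact: linear0.
  by move=> a x y Yx Yy; rewrite /Y /= linearP Yx Yy scaler0 add0r.
apply: (@compact_map_no_chain _ K Y (fun n => Y n.+1) l e cK) => //.
- move=> n; apply: (@preimage_closed _ _ (P n) [set 0]).
    by move=> x _; exact: Pcont.
  exact: (accessible_closed_set1 (hausdorff_accessible (@norm_hausdorff _ V))).
- move=> n; exists (v n).
    by rewrite /Y /= -vP subrr linear0.
  (* P m multiplies v n by the product of the l n - l i for i < m *)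
  suff /(_ _ (leqnn n)) : forall m, (m <= n)%N -> P m (v n) != 0.
    by move=> /eqP.
  elim=> [|m IH] mn; first exact: v0.
  have -> : P m.+1 (v n) = (l n - l m) *: P m (v n).
    by rewrite PS -vP -scalerBl; exact: linearZ_LR.
  rewrite scaler_eq0 negb_or; apply/andP; split; last exact: IH (ltnW mn).
  by rewrite subr_eq0; apply: contraTN mn => /eqP/linj ->; rewrite ltnn.
- left=> m n x mn Yx; rewrite /Y /= PK.
  by rewrite (Ple _ _ _ mn Yx) linear0.
Qed.

(** Apart from 0, the spectrum consists of eigenvalues, and it is the union over
n of the finite sets of those of modulus at least 1/(n+1). *)
Lemma compact_spectrum_countable V (K : {linear V -> V}) : compact_map K ->
  countable [set l : C | ~ bounded_inverse (l \*: idfun \- K)].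
Proof.
move=> cK; pose E (e : C) :=
  [set l : C | e <= `|l| /\ exists2 v, v != 0 & l *: v = K v].
apply: (@sub_countable _ _ _ (\bigcup_n ([set 0] `|` E n.+1%:R^-1))).
  apply: subset_card_le => l /= nl.
  have [->|l0] := eqVneq l 0; first by exists 0%N => //; left.
  have [|n ln] := @complex_natr_gt (`|l|^-1).
    by rewrite invr_ge0.
  exists n => //; right; split; last exact: fredholm_alternative.
  by rewrite -[leRHS]invrK lef_pV2 ?posrE ?invr_gt0 ?normr_gt0 ?ltr0n// ltW.
apply: bigcup_countable => // n _; apply: finite_set_countable.
rewrite finite_setU; split; first exact: finite_set1.
by apply: eigenvalues_away_from_0_finite; rewrite // invr_gt0 ltr0n.
Qed.

(** Eigenvalues near l have modulus at least |l|/2, hence are finite in number;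
it remains to remove those that differ from l. *)
Lemma nonzero_eigenvalue_isolated V (K : {linear V -> V}) (l : C) :
  compact_map K -> l != 0 ->
  exists U : set C^o, nbhs (l : C^o) U /\
    forall m v, U m -> v != 0 -> m *: v = K v -> m = l.
Proof.
move=> cK l0; have r0 : 0 < `|l| / 2 by rewrite divr_gt0// normr_gt0.
have fin := eigenvalues_away_from_0_finite cK r0.
set A := (X in finite_set X) in fin.
have Acl : closed (A `\ l : set C^o).
  apply: accessible_finite_set_closed.1; last exact: finite_setD.
  exact: (hausdorff_accessible (@norm_hausdorff _ C^o)).
exists (ball (l : C^o) (`|l| / 2) `&` ~` (A `\ l)); split.
  apply: filterI; first exact: nbhsx_ballx.
  by apply: open_nbhs_nbhs; split; [exact: closed_openC | move=> [_ /=]].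
move=> m v [lm nA] v0 mv; apply: contrapT => ml; apply: nA; split=> //.
split; last by exists v.
move: lm; rewrite -ball_normE /= => /ltW lm.
rewrite -(lerD2l (`|l| / 2)) -splitr -{1}[l](subrK m).
by rewrite (le_trans (ler_normD _ _))// lerD2r.
Qed.

(** * Spaces with compact identity *)

Lemma real_bounded_subsequence (u : nat -> R) (M : R) :
  (forall n, `|u n| <= M) ->
  exists phi : nat -> nat, {homo phi : m n / (m < n)%N} /\
    exists l : R, u \o phi @ \oo --> l.
Proof.
move=> uM; have [|phi hphi /cvg_ex[l ul]] := @bolzano_weierstrass R u.
  exists M; split; first exact: num_real.
  by move=> r /ltW Mr n _; exact: le_trans (uM n) Mr.
exists phi; split; last by exists l.
by move=> m n; rewrite !ltnNge -!leEnat hphi.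
Qed.

Lemma norm_real_complex (r : R) : `|r%:C%C| = `|r|%:C%C :> C.
Proof. by rewrite normc_def /= expr0n addr0 sqrtr_sqr. Qed.

Lemma cvg_real_complex (u : nat -> R) (l : R) : u @ \oo --> l ->
  (fun n => (u n)%:C%C : C^o) @ \oo --> (l%:C%C : C^o).
Proof.
move=> /cvgrPdist_lt ul; apply/cvgrPdist_lt => e e0.
have /complex_realP[r er] : e \is Num.real by exact: gtr0_real.
have [|N _ uN] := ul r; first by move: e0; rewrite er ltcR.
exists N => // n /uN; rewrite /= er -rmorphB norm_real_complex ltcR.
exact.
Qed.

Lemma scalar_bounded_subsequence (a : nat -> C) :
  (exists M : C, forall n, `|a n| <= M) ->
  exists phi : nat -> nat, exists l : C^o,
    {homo phi : m n / (m < n)%N} /\ (a \o phi : nat -> C^o) @ \oo --> l.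
Proof.
move=> [M aM].
have [r Mr] : exists r, M = r%:C%C.
  by apply/complex_realP/ger0_real; exact: le_trans (normr_ge0 _) (aM 0%N).
have Rer n : `|complex.Re (a n)| <= r.
  by rewrite -lecR -Mr; apply: le_trans (normc_ge_Re _) (aM n).
have Imr n : `|complex.Im (a n)| <= r.
  rewrite -lecR -Mr; apply: le_trans (aM n).
  rewrite -normrN -ReiNIm (le_trans (normc_ge_Re _))// normrM.
  by rewrite [X in _ * X]normc_def /= expr0n expr1n add0r sqrtr1 mulr1.
have [f [hf [x xf]]] := real_bounded_subsequence Rer.
have [g [hg [y yg]]] := real_bounded_subsequence (fun n => Imr (f n)).
exists (f \o g), (x%:C + 'i * y%:C)%C; split; first by move=> m n /hg/hf.
rewrite (_ : _ \o _ = (fun n => (complex.Re (a (f (g n))))%:C%C : C^o)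
    \+ ('i%C \*: (fun n => (complex.Im (a (f (g n))))%:C%C : C^o))).
  apply: cvgD; last by apply: cvgZl_tmp; exact: cvg_real_complex yg.
  exact: cvg_real_complex (cvg_comp _ _ (homo_lt_cvgnoo hg) xf).
by apply/funext => n; rewrite /= [LHS]complexE.
Qed.

(** For w a limit of t_n = y_n + a_n v with y_n in Y, the positive distance from
v to Y bounds the scalars a_n, so they subconverge to some l, and w - l v is a
limit of the corresponding y_n. *)
Lemma closed_subspace_add_line V (Y : set V) (v : V) :
  closed Y -> linear_subspace Y -> ~ Y v ->
  closed [set w | exists a : C, Y (w - a *: v)].
Proof.
move=> Ycl Ysub Yv w /closure_seq[t [/choice[a Yt] tw]].
have [y Yy ybest] := nearly_best_approximation Ycl Ysub.1 Yv.
have d0 : 0 < `|v - y|.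
  by rewrite normr_gt0 subr_eq0; apply/eqP => vy; apply: Yv; rewrite vy.
have ta n : `|a n| * `|v - y| <= `|t n| *+ 2.
  have [->|an0] := eqVneq (a n) 0; first by rewrite normr0 mul0r mulrn_wge0.
  rewrite mulrC -ler_pdivlMr ?normr_gt0// mulrnAl.
  apply: le_trans (ybest (- (a n)^-1 *: (t n - a n *: v)) _) _.
    exact: subspaceZ.
  rewrite scaleNr opprK scalerBr scalerA mulVf// scale1r addrC subrK normrZ.
  by rewrite normfV mulrC.
have [|phi [l [hphi al]]] := @scalar_bounded_subsequence a.
  exists ((`|w| + 1) *+ 2 / `|v - y|) => n.
  rewrite ler_pdivlMr// (le_trans (ta n))// lerMn2r; apply/orP; right.
  rewrite -[t n](subrK w) addrC (le_trans (ler_normD _ _))// lerD2l distrC.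
  by apply: le_trans (tw n) _; rewrite invf_le1 ?ler1n ?ltr0n.
exists l.
suff h : (fun n => t (phi n) - a (phi n) *: v) @ \oo --> w - l *: v.
  by apply: (closed_cvg Y Ycl _ _ h); apply: nearW => n /=.
apply: cvgB; last by apply: cvgZr_tmp.
apply: (cvg_comp _ _ (homo_lt_cvgnoo hphi)).
by apply: (@cvg_harmonic_bound _ _ _ 1) => // n; rewrite mul1r.
Qed.

(** The spans of the first vectors of an infinite independent sequence would
form a strictly increasing chain on which the identity acts as the scalar 1.
They are built by adding one line at a time, which is what makes them closed. *)
Lemma compact_identity_lin_indep_finite V (b : set V) :
  compact_map (idfun : V -> V) -> lin_indep b -> finite_set b.
Proof.
move=> cid indep; apply: contrapT => /infinite_set_seq[x [xinj bx]].
pose Y := fix Y n : set V :=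
  if n is m.+1 then [set w | exists a : C, Y m (w - a *: x m)] else [set 0].
have Ysub n : linear_subspace (Y n).
  elim: n => [|n [Y0 YD]].
    by split=> // a _ _ -> ->; rewrite /Y /= scaler0 addr0.
  split; first by exists 0; rewrite scale0r subr0.
  move=> a u v [c Yu] [d Yv]; exists (a * c + d).
  rewrite (_ : _ - _ = a *: (u - c *: x n) + (v - d *: x n)); first exact: YD.
  by rewrite scalerBr scalerDl -scalerA opprD addrACA.
have Yinc n : Y n `<=` Y n.+1.
  by move=> v Yv; exists 0; rewrite scale0r subr0.
have Yx n : Y n.+1 (x n).
  by exists 1; rewrite scale1r subrr; exact: (Ysub n).1.
have Yle m n : (m <= n)%N -> Y m `<=` Y n.
  elim: n => [|n IH]; first by rewrite leqn0 => /eqP ->.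
  rewrite leq_eqVlt => /predU1P[->//|]; rewrite ltnS => /IH YY v /YY.
  exact: Yinc.
have sum_with n (c : V -> C) a :
    \sum_(0 <= i < n.+1) [eta c with x n |-> a] (x i) *: x i =
    \sum_(0 <= i < n) c (x i) *: x i + a *: x n.
  rewrite big_nat_recr//= eqxx; congr (_ + _).
  by apply: eq_big_nat => i /= /ltn_eqF ni; rewrite (inj_eq xinj) ni.
have Yspan n w : Y n w ->
    exists c : V -> C, w = \sum_(0 <= i < n) c (x i) *: x i.
  elim: n w => [w ->|n IH w [a /IH[c wc]]].
    by exists (fun=> 0); rewrite big_geq.
  by exists [eta c with x n |-> a]; rewrite sum_with -wc subrK.
have Yxn n : ~ Y n (x n).
  move=> /Yspan[c xc].
  pose s := map x (index_iota 0 n.+1).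
  have s_uniq : uniq s by rewrite map_inj_uniq// iota_uniq.
  have s_b v : v \in s -> b v by move=> /mapP[i _ ->]; exact: bx.
  have s_sum : \sum_(v <- s) [eta c with x n |-> -1] v *: v = 0.
    by rewrite big_map sum_with -xc scaleN1r subrr.
  have s_xn : x n \in s by rewrite map_f// mem_index_iota ltnSn.
  have := indep s _ s_uniq s_b s_sum _ s_xn.
  by rewrite /= eqxx => /eqP; rewrite oppr_eq0 oner_eq0.
have Ycl n : closed (Y n).
  elim: n => [|n IH]; last exact: closed_subspace_add_line.
  exact: (accessible_closed_set1 (hausdorff_accessible (@norm_hausdorff _ V))).
apply: (@compact_map_no_chain _ idfun Y (fun n => Y n.+1)
  (fun=> 1) 1 cid) => //.
- by move=> n; rewrite normr1.
- by move=> n; exists (x n).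
- by move=> n v _ /=; rewrite scale1r subrr; exact: (Ysub n).1.
- by left=> m n v mn; exact: (Yle m.+1 n mn v).
Qed.

(** The identity is K composed with the bounded map - S, S inverting 0 - K. *)
Lemma bounded_inverse_compact_identity V (K : {linear V -> V}) :
  compact_map K -> bounded_inverse (0 \*: idfun \- K) ->
  compact_map (idfun : V -> V).
Proof.
move=> cK [S [[M SM] SK _]] x [B xB].
have [|phi [hphi [y Ky]]] := cK (fun n => - S (x n)).
  exists (`|M| * B) => n; rewrite normrN.
  have MS : 0 <= M * `|x n| by apply: le_trans (SM (x n)).
  by rewrite (le_trans (SM _))// -(ger0_norm MS) normrM normr_id ler_wpM2l.
exists phi; split=> //; exists y.
rewrite (_ : (fun n => _) = fun n => K (- S (x (phi n))))//.
by apply/funext => n /=; rewrite linearN -[LHS]SK /= scale0r sub0r.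
Qed.

End CompactOperators.

(** * Bicomplex operators *)

Lemma compact_op1 (R : realType) (B : bcBanach R) (K : bcop B) :
  compact_op K -> compact_map (op1 K).
Proof.
move=> cK x [M xM]; have [|phi [hphi [y [y1 _]]]] := cK (fun n => (x n, 0)).
  by exists M => n /=; rewrite normr0; split=> //; exact: le_trans (xM n).
by exists phi; split=> //; exists y.1.
Qed.

Lemma compact_op2 (R : realType) (B : bcBanach R) (K : bcop B) :
  compact_op K -> compact_map (op2 K).
Proof.
move=> cK x [M xM]; have [|phi [hphi [y [_ y2]]]] := cK (fun n => (0, x n)).
  by exists M => n /=; rewrite normr0; split=> //; exact: le_trans (xM n).
by exists phi; split=> //; exists y.2.
Qed.

Theorem theorem5 (R : realType) (B : bcBanach R) (K : bcop B)
    (cK : compact_op K) :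
  (forall z : bicomplex R,
     z \is a GRing.unit -> bc_spectrum K z -> bc_eigenvalue K z) /\
  (forall z : bicomplex R,
     limit_point (bc_eigenvalue K) z -> z \isn't a GRing.unit) /\
  (~ bc_finite_dimensional B -> bc_spectrum K 0) /\
  countable (bc_spectrum K).
Proof.
have cK1 := compact_op1 cK; have cK2 := compact_op2 cK.
split; [|split; [|split]].
- move=> z; rewrite bc_unitE => /andP[z1 z2] [nz1 nz2].
  have [v1 v10 zv1] := fredholm_alternative cK1 z1 nz1.
  have [v2 v20 zv2] := fredholm_alternative cK2 z2 nz2.
  exists (v1, v2); split=> //.
  by rewrite /bcapp /= zv1 zv2 !subrr.
- move=> z zlim; apply/negP; rewrite bc_unitE => /andP[z1 z2].
  have [U1 [U1z U1P]] := nonzero_eigenvalue_isolated cK1 z1.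
  have [U2 [U2z U2P]] := nonzero_eigenvalue_isolated cK2 z2.
  have zU : nbhs z (@bc_coord R @^-1` (U1 `*` U2)).
    apply: (@initial_continuous _ _ (@bc_coord R) z).
    by exists (U1, U2).
  have [y [yz [v [v1 v2 yv]] [y1 y2]]] := zlim _ zU.
  move/eqP: yz; apply; apply: bc_comp_inj.
    apply: U1P y1 v1 _; apply/eqP; rewrite -subr_eq0.
    exact/eqP/(congr1 fst yv).
  apply: U2P y2 v2 _; apply/eqP; rewrite -subr_eq0.
  exact/eqP/(congr1 snd yv).
(* an inverse of either component makes both bases finite *)
- have [b [c [bB cB bc]]] := comp_dim B.
  move=> infdim; split=> inv0; apply: infdim.
    have fb : finite_set b.
      apply: compact_identity_lin_indep_finite bB.1.
      apply: bounded_inverse_compact_identity cK1 _.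
      by move: inv0; rewrite /= /bc1 /= mulr0 subr0.
    by split; [exists b | exists c; split=> //; rewrite -(eq_finite_set bc)].
  have fc : finite_set c.
    apply: compact_identity_lin_indep_finite cB.1.
    apply: bounded_inverse_compact_identity cK2 _.
    by move: inv0; rewrite /= /bc2 /= mulr0 addr0.
  by split; [exists b; split=> //; rewrite (eq_finite_set bc) | exists c].
- apply: (@sub_countable _ _ _ ((fun p => bc_idem p.1 p.2) @`
    ([set l | ~ bounded_inverse (l \*: idfun \- op1 K)] `*`
     [set l | ~ bounded_inverse (l \*: idfun \- op2 K)]))).
    apply: subset_card_le => z [z1 z2]; exists (bc1 z, bc2 z) => //.
    by rewrite /bc_idem -bc_idemE.
  apply: sub_countable (card_image_le _ _) _.
  by apply: countableX; exact: compact_spectrum_countable.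
Qed.
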